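(* Let $H$ be a complex Hilbert space, let $T:H\to H$ be a nonzero bounded linear operator, and let $\lambda\in\mathbb{C}\setminus\{0\}$, $r>0$ with $|\lambda|>r$. If $$\|T-\lambda I\|\le r,$$ then $$\sqrt{1-\frac{r^2}{|\lambda|^2}}\le \frac{w(T)}{\|T\|}\le 1.$$
   Context: $I$ denotes the identity operator on $H$ and $\|\cdot\|$ the operator norm. The numerical radius of a bounded linear operator $T$ on $H$ is $w(T)=\sup\{|\langle Tx,x\rangle| : x\in H,\ \|x\|=1\}$. *)

(* Defs.v *)
From mathcomp Require Import all_boot all_order all_algebra.
From mathcomp Require Import complex.
From mathcomp Require Import boolp classical_sets reals topology normedtype.

Set Implicit Arguments.
Unset Strict Implicit.
Unset Printing Implicit Defensive.

Import Order.TTheory GRing.Theory Num.Theory.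
Import numFieldNormedType.Exports.

Local Open Scope classical_set_scope.
Local Open Scope ring_scope.

(* Norms over R[i], including the modulus on R[i] itself, take their values in
   R[i], where they are nonnegative reals; the real part brings them into R,
   where suprema and square roots are available. *)
Definition rnorm (R : realType) (V : normedZmodType R[i]) (x : V) : R :=
  complex.Re `|x|.

Definition bounded_operator (R : realType) (V : normedModType R[i])
    (f : V -> V) : Prop :=
  exists M : R, forall x : V, rnorm (f x) <= M * rnorm x.

(* A genuine supremum for bounded operators; [sup] is 0 on unbounded sets. *)
Definition opnorm (R : realType) (V : normedModType R[i]) (f : V -> V) : R :=
  sup [set rnorm (f x) | x in [set x : V | rnorm x <= 1]].

(* A genuine supremum for bounded operators on a nonzero space; [sup] is 0 on
   the empty set and on unbounded sets. *)
Definition numerical_radius (R : realType) (V : normedModType R[i])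
    (inner : V -> V -> R[i]) (f : V -> V) : R :=
  sup [set rnorm (inner (f x) x) | x in [set x : V | rnorm x = 1]].

(* Main.v *)
(** For a unit vector [x], expanding [|T x - lambda x|^2 <= r^2] gives
    [|T x|^2 + (|lambda|^2 - r^2) <= 2 Re (lambda^* <T x, x>) <= 2 |lambda| w(T)],
    and by AM-GM the left-hand side is at least
    [2 |T x| sqrt (|lambda|^2 - r^2)]. Taking the supremum over [x] gives the
    lower bound; the upper bound is Cauchy-Schwarz. *)
Require Import Defs.
From mathcomp Require Import all_boot all_order all_algebra.
From mathcomp Require Import complex ring lra.
From mathcomp Require Import boolp classical_sets reals topology normedtype.

Set Implicit Arguments.
Unset Strict Implicit.
Unset Printing Implicit Defensive.

Import Order.TTheory GRing.Theory Num.Theory.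
Import numFieldNormedType.Exports.

Local Open Scope ring_scope.

Lemma rnormE (R : realType) (V : normedZmodType R[i]) (x : V) :
  `|x| = (rnorm x)%:C%C.
Proof. by rewrite /rnorm RRe_real// normr_real. Qed.

Lemma rnorm_ge0 (R : realType) (V : normedZmodType R[i]) (x : V) :
  0 <= rnorm x.
Proof. by rewrite -ler0c -rnormE. Qed.

Lemma rnorm_eq0 (R : realType) (V : normedZmodType R[i]) (x : V) :
  (rnorm x == 0) = (x == 0).
Proof. by rewrite -[RHS]normr_eq0 rnormE (inj_eq (@complexI R)). Qed.

Lemma rnorm0 (R : realType) (V : normedZmodType R[i]) : rnorm (0 : V) = 0.
Proof. by apply/eqP; rewrite rnorm_eq0. Qed.

Lemma rnormZ (R : realType) (V : normedModType R[i]) (a : R[i]) (x : V) :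
  rnorm (a *: x) = rnorm a * rnorm x.
Proof. by apply: (@complexI R); rewrite rmorphM/= -!rnormE normrZ. Qed.

Lemma rnormM (R : realType) (a b : R[i]) : rnorm (a * b) = rnorm a * rnorm b.
Proof. by apply: (@complexI R); rewrite rmorphM/= -!rnormE normrM. Qed.

Lemma rnorm_real (R : realType) (k : R) : 0 <= k -> rnorm (k%:C%C) = k.
Proof. by move=> k0; rewrite /rnorm ger0_norm ?ler0c. Qed.

Lemma ler_rnormB (R : realType) (V : normedZmodType R[i]) (x y : V) :
  rnorm (x - y) <= rnorm x + rnorm y.
Proof. by rewrite -lecR rmorphD/= -!rnormE ler_normB. Qed.

Lemma Re_le_rnorm (R : realType) (z : R[i]) : complex.Re z <= rnorm z.
Proof.
by apply: le_trans (ler_norm _) _; rewrite -lecR -rnormE normc_ge_Re.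
Qed.

Lemma rnorm_conjc (R : realType) (z : R[i]) : rnorm (conjc z) = rnorm z.
Proof. by rewrite /rnorm normcJ. Qed.

Lemma rnorm_normalize (R : realType) (V : normedModType R[i]) (x : V) :
  x != 0 -> rnorm ((rnorm x)^-1%:C%C *: x) = 1.
Proof.
move=> x0; rewrite rnormZ rnorm_real ?invr_ge0 ?rnorm_ge0//.
by rewrite mulVf// rnorm_eq0.
Qed.

Lemma bounded_operator_ubound (R : realType) (V : normedModType R[i])
    (f : V -> V) : bounded_operator f ->
  exists2 M : R, 0 <= M & forall x, rnorm x <= 1 -> rnorm (f x) <= M.
Proof.
(* The constant [M] carries no sign condition, so its absolute value serves as the nonnegative
   bound. *)
move=> [M Mf]; exists `|M| => // x x1; apply: le_trans (Mf x) _.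
apply: le_trans (ler_norm _) _.
by rewrite normrM ler_piMr// ger0_norm ?rnorm_ge0.
Qed.

Lemma rnorm_le_opnorm (R : realType) (V : normedModType R[i])
    (f : V -> V) (x : V) :
  bounded_operator f -> rnorm x <= 1 -> rnorm (f x) <= opnorm f.
Proof.
move=> /bounded_operator_ubound[M _ Mf] x1.
apply: ub_le_sup; last by exists x.
by exists M => _ [y y1 <-]; exact: Mf.
Qed.

(** By homogeneity, unit vectors suffice: a nonzero [x] of the unit ball is normalized, which gives
    [rnorm (f x) <= C * rnorm x <= C]. The condition [0 <= C] covers [x = 0], the only vector there
    is in a trivial space. *)
Lemma opnorm_le (R : realType) (V : normedModType R[i])
    (f : {linear V -> V}) (C : R) : 0 <= C ->
  (forall x, rnorm x = 1 -> rnorm (f x) <= C) -> opnorm f <= C.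
Proof.
move=> C0 fC; apply: ge_sup.
  by exists (rnorm (f 0)), 0 => //=; rewrite rnorm0 ler01.
move=> _ [x /= x1 <-]; have [->|x0] := eqVneq x 0; first by rewrite linear0 rnorm0.
have := fC _ (rnorm_normalize x0).
rewrite linearZ/= rnormZ rnorm_real ?invr_ge0 ?rnorm_ge0//.
rewrite ler_pdivrMl ?lt_def ?rnorm_eq0 ?x0 ?rnorm_ge0// => /le_trans; apply.
by rewrite ler_piMl.
Qed.

(** If the norm were at most 0, [f] would vanish on every normalized vector, hence everywhere by
    linearity. *)
Lemma opnorm_gt0 (R : realType) (V : normedModType R[i])
    (f : {linear V -> V}) :
  bounded_operator f -> ~ (f =1 \0) -> 0 < opnorm f.
Proof.
move=> bf f0; rewrite ltNge; apply/negP => fle0; apply: f0 => x /=.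
have [->|x0] := eqVneq x 0; first by rewrite linear0.
have := rnorm_le_opnorm bf (_ : rnorm ((rnorm x)^-1%:C%C *: x) <= 1).
rewrite rnorm_normalize// => /(_ (lexx _))/le_trans/(_ fle0).
rewrite le_eqVlt ltNge rnorm_ge0 orbF rnorm_eq0 linearZ scaler_eq0 => /orP[|/eqP//].
by rewrite (inj_eq (@complexI R)) invr_eq0 rnorm_eq0 (negPf x0).
Qed.

(** This makes the supremum defining the norm of [f \- a \*: idfun] genuine, so that a bound on that
    norm controls individual vectors. *)
Lemma bounded_operatorBZ (R : realType) (V : normedModType R[i])
    (f : V -> V) (a : R[i]) :
  bounded_operator f -> bounded_operator (f \- a \*: idfun).
Proof.
move=> [M Mf]; exists (M + rnorm a) => x /=.
by rewrite mulrDl -rnormZ; apply: le_trans (ler_rnormB _ _) _; rewrite lerD2r.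
Qed.

Section inner_product.
Variables (R : realType) (H : normedModType R[i]).
Variable inner : {dot H for @conjc R}.
Hypothesis inner_norm : forall x : H, inner x x = `|x| ^+ 2.

(** The form is conjugate-linear in its second argument, and Hermitian symmetry makes the two cross
    terms conjugate, so they add up to twice a real part. *)
Lemma sqr_rnormBZ (u x : H) (a : R[i]) : rnorm x = 1 ->
  rnorm (u - a *: x) ^+ 2 =
    rnorm u ^+ 2 - 2 * complex.Re (conjc a * inner u x) + rnorm a ^+ 2.
Proof.
move=> x1; apply: (@complexI R).
have xx : inner x x = 1 by rewrite inner_norm rnormE x1 expr1n.
have xu : inner x u = conjc (inner u x).
  by rewrite hermC/= expr0 mul1r.
rewrite rmorphXn/= -rnormE -inner_norm.
rewrite linearBl !linearBr/= !linearZl_LR !linearZr_LR/= xx xu inner_norm rnormE.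
have Re2 (z : R[i]) : (2 * complex.Re z)%:C%C = z + conjc z.
  by rewrite rmorphM/= rmorph_nat -addcJ.
rewrite rmorphD rmorphB !rmorphXn/= -[(rnorm a)%:C%C]rnormE sqr_normc.
rewrite Re2 rmorphM/= conjcK; ring.
Qed.

(** Cauchy-Schwarz for a unit vector: with [d = inner u x], the vector [d *: x] is the projection of
    [u] on the line of [x], and the squared distance from [u] to it is
    [rnorm u ^+ 2 - rnorm d ^+ 2], which is nonnegative. *)
Lemma rnorm_inner_le (u x : H) : rnorm x = 1 -> rnorm (inner u x) <= rnorm u.
Proof.
move=> x1; set d := inner u x.
have := sqr_rnormBZ u d x1; rewrite -/d.
have -> : complex.Re (conjc d * d) = rnorm d ^+ 2.
  by rewrite mulrC -sqr_normc rnormE -rmorphXn.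
move=> e; rewrite -(@ler_sqr R) ?nnegrE ?rnorm_ge0//.
have := sqr_ge0 (rnorm (u - d *: x)); rewrite e; lra.
Qed.

Lemma numerical_radius_le (f : H -> H) :
  bounded_operator f -> 0 <= opnorm f -> numerical_radius inner f <= opnorm f.
Proof.
move=> bf f0; rewrite /numerical_radius; set A := (X in sup X).
(* A trivial space has no unit vector; the supremum is then 0 by default, and [0 <= opnorm f]
   concludes. *)
have [->|/set0P A0] := eqVneq A set0; first by rewrite sup0.
apply: ge_sup => // _ [x /= x1 <-].
by apply: le_trans (rnorm_inner_le _ x1) (rnorm_le_opnorm bf _); rewrite x1.
Qed.

Lemma rnorm_le_numerical_radius (f : H -> H) (x : H) :
  bounded_operator f -> rnorm x = 1 ->
  rnorm (inner (f x) x) <= numerical_radius inner f.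
Proof.
move=> bf x1; apply: ub_le_sup; last by exists x.
exists (opnorm f) => _ [y /= y1 <-].
by apply: le_trans (rnorm_inner_le _ y1) (rnorm_le_opnorm bf _); rewrite y1.
Qed.

Lemma numerical_radius_ge0 (f : H -> H) : 0 <= numerical_radius inner f.
Proof.
rewrite /numerical_radius; set A := (X in sup X).
(* A genuine supremum dominates some modulus; otherwise its default value is 0. *)
have [[[y Ay] A_ub]|/sup_out->//] := pselect (has_sup A).
apply: le_trans (ub_le_sup A_ub Ay).
by case: Ay => x _ <-; exact: rnorm_ge0.
Qed.

Lemma rnorm_sqrt_le (f : H -> H) (a : R[i]) (r : R) (x : H) :
  bounded_operator f -> 0 <= r <= rnorm a ->
  opnorm (f \- a \*: idfun) <= r -> rnorm x = 1 ->
  rnorm (f x) * Num.sqrt (rnorm a ^+ 2 - r ^+ 2) <=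
    rnorm a * numerical_radius inner f.
Proof.
move=> bf /andP[r0 ra] fr x1; set s := Num.sqrt _.
have s2 : s ^+ 2 = rnorm a ^+ 2 - r ^+ 2.
  by rewrite sqr_sqrtr// subr_ge0 ler_sqr ?nnegrE ?rnorm_ge0.
have near : rnorm (f x - a *: x) ^+ 2 <= r ^+ 2.
  rewrite ler_sqr ?nnegrE ?rnorm_ge0//; apply: le_trans fr.
  by apply: (rnorm_le_opnorm (bounded_operatorBZ a bf)); rewrite x1.
have Re_le : complex.Re (conjc a * inner (f x) x) <=
    rnorm a * numerical_radius inner f.
  apply: le_trans (Re_le_rnorm _) _; rewrite rnormM rnorm_conjc.
  by rewrite ler_wpM2l ?rnorm_ge0// rnorm_le_numerical_radius.
(* Since [s ^+ 2] is [rnorm a ^+ 2 - r ^+ 2], adding this inequality to the expanded [near] cancels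
   all the squares; [Re_le] then bounds what remains. *)
have amgm := sqr_ge0 (rnorm (f x) - s).
move: near; rewrite sqr_rnormBZ//; move: amgm; rewrite sqrrB s2 mulr2n; lra.
Qed.

End inner_product.

Theorem theorem9 (R : realType) (H : completeNormedModType R[i])
    (inner : {dot H for @conjc R})
    (inner_norm : forall x : H, inner x x = `|x| ^+ 2)
    (T : {linear H -> H}) (T_bounded : bounded_operator T)
    (T_neq0 : ~ (T =1 \0))
    (lambda : R[i]) (lambda_neq0 : lambda != 0)
    (r : R) (r_gt0 : 0 < r) (r_lt : r < rnorm lambda)
    (T_near : opnorm (T \- lambda \*: idfun) <= r) :
  Num.sqrt (1 - r ^+ 2 / rnorm lambda ^+ 2)
    <= numerical_radius inner T / opnorm T <= 1.
Proof.
have T0 := opnorm_gt0 T_bounded T_neq0.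
apply/andP; split; last first.
  by rewrite ler_pdivrMr// mul1r numerical_radius_le// ltW.
have l0 : 0 < rnorm lambda by exact: lt_trans r_lt.
have s0 : 0 < Num.sqrt (rnorm lambda ^+ 2 - r ^+ 2).
  by rewrite sqrtr_gt0 subr_gt0 ltr_sqr ?nnegrE ?ltW.
(* Factoring out the inverse square splits the root into [Num.sqrt (rnorm lambda ^+ 2 - r ^+ 2)]
   over [rnorm lambda]. *)
have -> : 1 - r ^+ 2 / rnorm lambda ^+ 2 =
    (rnorm lambda ^+ 2 - r ^+ 2) * (rnorm lambda)^-1 ^+ 2.
  by rewrite exprVn mulrBl divff// expf_neq0// gt_eqF.
rewrite sqrtrM; last by rewrite ltW// -sqrtr_gt0.
rewrite sqrtr_sqr gtr0_norm ?invr_gt0// ler_pdivlMr// mulrAC ler_pdivrMr//.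
(* Dividing by the positive root isolates [opnorm T], which reduces the claim to unit vectors. *)
rewrite mulrC [leRHS]mulrC -ler_pdivlMr//; apply: opnorm_le => [|x x1].
  by rewrite divr_ge0 ?mulr_ge0 ?numerical_radius_ge0 ?ltW.
rewrite ler_pdivlMr//; apply: rnorm_sqrt_le => //.
by rewrite !ltW.
Qed.
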